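(* Let $\lambda\in\mathbb{K}$. (a) Let $(A,\prec_A,\succ_A,P,\omega)$ be a quadratic Rota-Baxter dendriform algebra of weight $\lambda$. Then $(A,\ast,P,\omega)$ is a Rota-Baxter associative algebra with a nondegenerate Connes cocycle $\omega$ of weight $\lambda$, where $x\ast y=x\prec_A y+x\succ_A y$. (b) Conversely, let $(A,\ast,P,\omega)$ be a Rota-Baxter associative algebra with a nondegenerate Connes cocycle of weight $\lambda$. Then $(A,\prec_A,\succ_A,P,\omega)$ is a quadratic Rota-Baxter dendriform algebra of weight $\lambda$, where the dendriform multiplications $\prec_A,\succ_A$ are determined by $$\omega(x\succ_A y,z)=\omega(y,z\ast x),\qquad \omega(x\prec_A y,z)=\omega(x,y\ast z),\qquad\forall x,y,z\in A.$$
   Context: All vector spaces are finite-dimensional over a field $\mathbb{K}$. A dendriform algebra $(A,\prec_A,\succ_A)$ is a vector space with two bilinear products such that, with $x\ast y=x\prec_A y+x\succ_A y$, for all $x,y,z$: $(x\prec_A y)\prec_A z=x\prec_A(y\ast z)$, $(x\succ_A y)\prec_A z=x\succ_A(y\prec_A z)$, $x\succ_A(y\succ_A z)=(x\ast y)\succ_A z$. Then $(A,\ast)$ is an associative algebra. A Rota-Baxter operator of weight $\lambda$ on $(A,\prec_A,\succ_A)$ is a linear map $P:A\to A$ with $P(x)\prec_A P(y)=P(P(x)\prec_A y+x\prec_A P(y)+\lambda x\prec_A y)$ and $P(x)\succ_A P(y)=P(P(x)\succ_A y+x\succ_A P(y)+\lambda x\succ_A y)$; then $(A,\prec_A,\succ_A,P)$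 is a Rota-Baxter dendriform algebra of weight $\lambda$. A Rota-Baxter associative algebra $(A,\ast,P)$ of weight $\lambda$ is an associative algebra with a linear map $P$ satisfying $P(x)\ast P(y)=P(P(x)\ast y+x\ast P(y)+\lambda x\ast y)$. A quadratic dendriform algebra $(A,\prec_A,\succ_A,\omega)$ is a dendriform algebra with a nondegenerate skew-symmetric bilinear form $\omega\in\wedge^2A^*$ satisfying $\omega(x\succ_A y,z)=-\omega(x,y\prec_A z)=\omega(y,z\ast x)$ for all $x,y,z\in A$. A Connes cocycle on an associative algebra $(A,\ast)$ is a skew-symmetric bilinear form $\omega\in\wedge^2A^*$ with $\omega(x\ast y,z)+\omega(y\ast z,x)+\omega(z\ast x,y)=0$ for all $x,y,z\in A$. Compatibility condition (C): $\omega(Px,y)+\omega(x,Py)+\lambda\omega(x,y)=0$ for all $x,y\in A$. A quadratic Rota-Baxter dendriform algebra of weight $\lambda$ is a tuple $(A,\prec_A,\succ_A,P,\omega)$ such that $(A,\prec_A,\succ_A,P)$ is a Rota-Baxter dendriform algebra of weight $\lambda$, $(A,\prec_A,\succ_A,\omega)$ is a quadratic dendriform algebra, and (C) holds. A Rota-Baxter associative algebra with a nondegenerate Connes cocycle of weight $\lambda$ is a tuple $(A,\ast,P,\omega)$ such that $(A,\ast,P)$ is a Rota-Baxter associative algebra of weight $\lambda$, $\omega$ is a nondegenerate Connes cocycle on $(A,\ast)$, and (C) holds. *)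

(* Defs.v *)
From HB Require Import structures.
From mathcomp Require Import all_boot all_order all_algebra.

Set Implicit Arguments.
Unset Strict Implicit.
Unset Printing Implicit Defensive.

Import GRing.Theory.
Local Open Scope ring_scope.

Section Products.
Variables (K : fieldType) (A : vectType K).

Definition dend_sum (prec succ : A -> A -> A) (x y : A) : A :=
  prec x y + succ x y.

Lemma dend_sum_bilinear (prec succ : {bilinear A -> A -> A}) :
  bilinear_for *:%R *:%R (dend_sum prec succ).
Proof.
by split=> u a x y; rewrite /dend_sum /= ?linearPl ?linearPr /= scalerDr addrACA.
Qed.

HB.instance Definition _ (prec succ : {bilinear A -> A -> A}) :=
  bilinear_isBilinear.Build K A A A *:%R *:%R (dend_sum prec succ)
    (dend_sum_bilinear prec succ).

Definition is_dendriform (prec succ : {bilinear A -> A -> A}) : Prop :=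
  forall x y z : A,
    [/\ prec (prec x y) z = prec x (dend_sum prec succ y z),
        prec (succ x y) z = succ x (prec y z)
      & succ x (succ y z) = succ (dend_sum prec succ x y) z].

(* No unit is required. *)
Definition is_assoc (mul : {bilinear A -> A -> A}) : Prop := associative mul.

Definition rota_baxter_identity (lambda : K) (mul : {bilinear A -> A -> A})
    (P : {linear A -> A}) : Prop :=
  forall x y : A,
    mul (P x) (P y) = P (mul (P x) y + mul x (P y) + lambda *: mul x y).

Definition is_rb_dendriform (lambda : K) (prec succ : {bilinear A -> A -> A})
    (P : {linear A -> A}) : Prop :=
  [/\ is_dendriform prec succ,
      rota_baxter_identity lambda prec P
    & rota_baxter_identity lambda succ P].

Definition is_rb_assoc (lambda : K) (mul : {bilinear A -> A -> A})
    (P : {linear A -> A}) : Prop :=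
  is_assoc mul /\ rota_baxter_identity lambda mul P.

(* In the definitions below omega is an element of [{skew_symmetric A}], i.e. a
   bilinear form with omega x y = - omega y x; in characteristic 2 it need not
   be alternating. *)

Definition is_quadratic_dendriform (prec succ : {bilinear A -> A -> A})
    (omega : {skew_symmetric A}) : Prop :=
  [/\ is_dendriform prec succ,
      nondegenerate omega
    & forall x y z : A,
        omega (succ x y) z = - omega x (prec y z)
        /\ - omega x (prec y z) = omega y (dend_sum prec succ z x)].

Definition is_connes_cocycle (mul : {bilinear A -> A -> A})
    (omega : {skew_symmetric A}) : Prop :=
  forall x y z : A,
    omega (mul x y) z + omega (mul y z) x + omega (mul z x) y = 0.

Definition rb_compatible (lambda : K) (P : {linear A -> A})
    (omega : {skew_symmetric A}) : Prop :=
  forall x y : A, omega (P x) y + omega x (P y) + lambda * omega x y = 0.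

Definition is_quadratic_rb_dendriform (lambda : K)
    (prec succ : {bilinear A -> A -> A}) (P : {linear A -> A})
    (omega : {skew_symmetric A}) : Prop :=
  [/\ is_rb_dendriform lambda prec succ P,
      is_quadratic_dendriform prec succ omega
    & rb_compatible lambda P omega].

Definition is_rb_assoc_connes (lambda : K) (mul : {bilinear A -> A -> A})
    (P : {linear A -> A}) (omega : {skew_symmetric A}) : Prop :=
  [/\ is_rb_assoc lambda mul P,
      nondegenerate omega,
      is_connes_cocycle mul omega
    & rb_compatible lambda P omega].

Definition cocycle_products (mul : {bilinear A -> A -> A})
    (omega : {skew_symmetric A}) (prec succ : A -> A -> A) : Prop :=
  forall x y z : A,
    omega (succ x y) z = omega y (mul z x)
    /\ omega (prec x y) z = omega x (mul y z).

End Products.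

(* Main.v *)
From HB Require Import structures.
Require Import Defs.
From mathcomp Require Import all_boot all_order all_algebra.

Set Implicit Arguments.
Unset Strict Implicit.
Unset Printing Implicit Defensive.

Import GRing.Theory.
Local Open Scope ring_scope.

(** A nondegenerate form identifies [A] with its dual, so that every product
    [x . y] is determined by the trilinear form [omega (x . y) z]: this gives
    existence, uniqueness and bilinearity of the two dendriform products, and
    reduces each identity between products to one between scalars.  The cocycle
    condition says exactly that [x * y = x < y + x > y].  By (C), the
    [omega]-adjoint of [P] is [- (P + lambda)], and moving [P] to the other
    argument turns the Rota-Baxter identity of [*] into those of [<] and [>]. *)

Section SkewForm.
Variables (K : fieldType) (A : vectType K) (omega : {skew_symmetric A}).

Lemma skew_formC (x y : A) : omega x y = - omega y x.
Proof. by rewrite [LHS]hermitian_subproof expr1 mulN1r. Qed.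

Hypothesis omega_nondeg : nondegenerate omega.

Lemma nondegenerate_inj (u v : A) : (forall z, omega u z = omega v z) -> u = v.
Proof.
move=> eq_uv; apply/eqP; rewrite -subr_eq0 -memv0 -(eqP omega_nondeg).
by apply/mem_orthovP => z _; rewrite linearBl /= eq_uv subrr.
Qed.

(** The map from [A] to its dual that sends [a] to [omega a _], written in coordinates on [vbasis],
    so that the target is a [vectType] to which [linfun] applies. *)
Let basis_row (a : A) : 'rV[K]_(\dim {:A}) :=
  \row_j omega a (vbasis {:A})`_j.

Let basis_row_linear : linear basis_row.
Proof. by move=> k u v; apply/rowP => j; rewrite !mxE linearPl. Qed.

HB.instance Definition _ :=
  GRing.isLinear.Build K A 'rV[K]_(\dim {:A}) _ basis_row basis_row_linear.

Let basis_row_inj : injective basis_row.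
Proof.
move=> u v /rowP eq_uv; apply: nondegenerate_inj => z.
rewrite (coord_vbasis (memvf z)) !linear_sumr; apply: eq_bigr => j _.
by rewrite !linearZr_LR /=; have := eq_uv j; rewrite !mxE => ->.
Qed.

Let lker_basis_row : lker (linfun basis_row) == 0%VS.
Proof. by apply/lker0P => u v; rewrite !lfunE; apply: basis_row_inj. Qed.

(** An injective linear map between spaces of equal dimension is onto. *)
Let limg_basis_row : limg (linfun basis_row) = fullv.
Proof.
apply/eqP; rewrite eqEdim subvf /= limg_dim_eq; last first.
  by rewrite (eqP lker_basis_row) capv0.
by rewrite [leqLHS]dimvf dim_matrix; apply: eq_leq; apply: mul1n.
Qed.

(** The vector that represents a functional through [omega]. Only the values of [f] on a basis
    enter, so linearity is asked for in [representE] alone. *)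
Definition represent (f : A -> K) : A :=
  (linfun basis_row)^-1%VF (\row_j f (vbasis {:A})`_j).

Lemma representE (f : {scalar A}) z : omega (represent f) z = f z.
Proof.
rewrite [in RHS](coord_vbasis (memvf z)) [in LHS](coord_vbasis (memvf z)).
rewrite linear_sumr linear_sum; apply: eq_bigr => j _.
rewrite linearZr_LR linearZ /=; congr (_ * _).
(* On basis vectors, surjectivity makes [^-1] a right inverse of [basis_row]. *)
have := @limg_lfunVK _ _ _ (linfun basis_row) (\row_j f (vbasis {:A})`_j).
by rewrite limg_basis_row memvf => /(_ isT); rewrite lfunE => /rowP/(_ j); rewrite !mxE.
Qed.

End SkewForm.

Section QuadraticToConnes.
Variables (K : fieldType) (A : vectType K) (lambda : K).
Variables (prec succ : {bilinear A -> A -> A}) (P : {linear A -> A}).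

(** Each bracketing expands into three terms, which the three dendriform axioms match one by one. *)
Lemma dend_sum_assoc :
  is_dendriform prec succ -> is_assoc (dend_sum prec succ).
Proof.
move=> dend x y z; have [pp sp ss] := dend x y z.
rewrite /= [LHS]/dend_sum [RHS]/dend_sum -pp -ss.
by rewrite /dend_sum linearDl linearDr /= sp addrA.
Qed.

Lemma dend_sum_rota_baxter :
  rota_baxter_identity lambda prec P -> rota_baxter_identity lambda succ P ->
  rota_baxter_identity lambda (dend_sum prec succ) P.
Proof.
move=> RBp RBs x y; rewrite /= /dend_sum RBp RBs -linearD /=; congr (P _).
by rewrite scalerDr [LHS]addrACA; congr (_ + _); rewrite addrACA.
Qed.

(** Invariance at [(x, y, z)] turns the [succ] part of the first term into [omega y (z * x)]; at the
    rotated triple [(z, x, y)] it turns the [prec] part into [omega x (y * z)]. By skew-symmetry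
    these cancel the other two terms. *)
Lemma quadratic_dendriform_cocycle (omega : {skew_symmetric A}) :
  is_quadratic_dendriform prec succ omega ->
  is_connes_cocycle (dend_sum prec succ) omega.
Proof.
case=> _ _ inv x y z; have [invs invp] := inv x y z.
have [_ invp'] := inv z x y.
rewrite /= {1}/dend_sum linearDl /= invs invp.
rewrite (skew_formC _ (prec x y)) invp'.
by rewrite !(skew_formC _ (dend_sum prec succ _ _)) -addrA -opprD subrr.
Qed.

End QuadraticToConnes.

Section ConnesToQuadratic.
Variables (K : fieldType) (A : vectType K) (omega : {skew_symmetric A}).
Hypothesis omega_nondeg : nondegenerate omega.
Variable mul : {bilinear A -> A -> A}.

Lemma cocycle_products_uniq (prec succ prec' succ' : A -> A -> A) :
  cocycle_products mul omega prec succ ->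
  cocycle_products mul omega prec' succ' ->
  prec' =2 prec /\ succ' =2 succ.
Proof.
move=> cp cp'; split=> x y; apply: (nondegenerate_inj omega_nondeg) => z;
  have [succE precE] := cp x y z; have [succE' precE'] := cp' x y z.
- by rewrite precE precE'.
- by rewrite succE succE'.
Qed.

Lemma cocycle_products_exist :
  exists prec succ : {bilinear A -> A -> A},
    cocycle_products mul omega prec succ.
Proof.
(* For fixed [x] and [y], each prescribed right-hand side is a functional of [z], hence has a
   representing vector. *)
have Ls x y : scalar (fun z => omega y (mul z x)).
  by move=> k u v; rewrite linearPl linearPr.
have Lp x y : scalar (fun z => omega x (mul y z)).
  by move=> k u v; rewrite !linearPr.
pose fs x y : {scalar A} := HB.pack (fun z => omega y (mul z x))
  (GRing.isLinear.Build K A K *%R _ (Ls x y)).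
pose fp x y : {scalar A} := HB.pack (fun z => omega x (mul y z))
  (GRing.isLinear.Build K A K *%R _ (Lp x y)).
pose succ x y := represent omega (fs x y).
pose prec x y := represent omega (fp x y).
have succE x y z : omega (succ x y) z = omega y (mul z x).
  exact: representE.
have precE x y z : omega (prec x y) z = omega x (mul y z).
  exact: representE.
have succ_bil : bilinear_for *:%R *:%R succ.
  split=> w k u v; apply: (nondegenerate_inj omega_nondeg) => z;
  by rewrite linearPl /= !succE ?linearPr ?linearPl /= ?linearPr.
have prec_bil : bilinear_for *:%R *:%R prec.
  split=> w k u v; apply: (nondegenerate_inj omega_nondeg) => z;
  by rewrite linearPl /= !precE ?linearPl ?linearPr /= ?linearPr.
pose succB : {bilinear A -> A -> A} := HB.pack succ
  (bilinear_isBilinear.Build K A A A *:%R *:%R succ succ_bil).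
pose precB : {bilinear A -> A -> A} := HB.pack prec
  (bilinear_isBilinear.Build K A A A *:%R *:%R prec prec_bil).
by exists precB, succB.
Qed.

Variables prec succ : {bilinear A -> A -> A}.
Hypothesis products : cocycle_products mul omega prec succ.

Let succE x y z : omega (succ x y) z = omega y (mul z x).
Proof. by have [] := products x y z. Qed.

Let precE x y z : omega (prec x y) z = omega x (mul y z).
Proof. by have [] := products x y z. Qed.

Lemma cocycle_dend_sum :
  is_connes_cocycle mul omega -> dend_sum prec succ =2 mul.
Proof.
move=> cocycle x y; apply: (nondegenerate_inj omega_nondeg) => z.
rewrite linearDl /= precE succE.
rewrite (skew_formC omega x) (skew_formC omega y) -opprD; apply/esym/eqP.
by rewrite -addr_eq0 addrA cocycle.
Qed.

(** Once [dend_sum] is known to be [mul], pairing a dendriform axiom with [t] leaves one of [x],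
    [y], [z] against two bracketings of the same product of the other two and [t], which [mulA]
    identifies. *)
Lemma cocycle_quadratic :
  is_assoc mul -> is_connes_cocycle mul omega ->
  is_quadratic_dendriform prec succ omega.
Proof.
move=> mulA cocycle; have sumE := cocycle_dend_sum cocycle.
split=> // x y z; last first.
  by rewrite sumE succE -skew_formC precE.
rewrite !sumE; split; apply: (nondegenerate_inj omega_nondeg) => t.
- by rewrite !precE -mulA.
- by rewrite precE !succE precE mulA.
- by rewrite !succE mulA.
Qed.

Variables (lambda : K) (P : {linear A -> A}).
Hypothesis compat : rb_compatible lambda P omega.

Let adjoint x y : omega (P x) y = - omega x (P y + lambda *: y).
Proof.
apply/eqP; rewrite -addr_eq0 linearDr linearZr_LR /= addrA.
exact/eqP/compat.
Qed.

Let adjoint_shift x y : omega (P x + lambda *: x) y = - omega x (P y).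
Proof. by rewrite skew_formC -adjoint skew_formC. Qed.

Hypothesis mul_rb : rota_baxter_identity lambda mul P.

(** Pairing with [z] and moving every operator off [y] gives [omega y _] on both sides; the second
    arguments agree by the Rota-Baxter identity of [mul] at [(z, x)]. *)
Lemma succ_rota_baxter : rota_baxter_identity lambda succ P.
Proof.
move=> x y; apply: (nondegenerate_inj omega_nondeg) => z.
(* The weight term joins [P y], so that [adjoint_shift] can move [P + lambda] off [y]. *)
have -> : succ (P x) y + succ x (P y) + lambda *: succ x y
        = succ (P x) y + succ x (P y + lambda *: y).
  by rewrite linearDr linearZr_LR addrA.
rewrite succE adjoint [RHS]adjoint linearDl /=.
rewrite !succE adjoint_shift -linearBr; congr (- omega y _).
rewrite !linearDl /= !linearZl_LR /= mul_rb addrAC -linearB /=; congr (P _ + _).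
by rewrite [X in X - _]addrAC [RHS]addrAC subrr add0r.
Qed.

Lemma prec_rota_baxter : rota_baxter_identity lambda prec P.
Proof.
move=> x y; apply: (nondegenerate_inj omega_nondeg) => z.
(* Here the argument to be freed is [x], so the weight term joins [P x]; what remains is the
   identity of [mul] at [(y, z)]. *)
have -> : prec (P x) y + prec x (P y) + lambda *: prec x y
        = prec x (P y) + prec (P x + lambda *: x) y.
  by rewrite linearDl /= linearZl_LR addrCA addrA.
rewrite precE adjoint [RHS]adjoint linearDl /=.
rewrite !precE adjoint_shift -linearBr; congr (- omega x _).
rewrite !linearDr /= !linearZr_LR /= mul_rb addrAC -linearB /=; congr (P _ + _).
by rewrite -[X in X - _]addrA addrK.
Qed.

End ConnesToQuadratic.

Theorem theorem4p5 (K : fieldType) (A : vectType K) (lambda : K) :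
  (forall (prec succ : {bilinear A -> A -> A}) (P : {linear A -> A})
      (omega : {skew_symmetric A}),
    is_quadratic_rb_dendriform lambda prec succ P omega ->
    is_rb_assoc_connes lambda (dend_sum prec succ) P omega)
  /\
  (forall (mul : {bilinear A -> A -> A}) (P : {linear A -> A})
      (omega : {skew_symmetric A}),
    is_rb_assoc_connes lambda mul P omega ->
    exists prec succ : {bilinear A -> A -> A},
      [/\ cocycle_products mul omega prec succ,
          forall prec' succ' : A -> A -> A,
            cocycle_products mul omega prec' succ' ->
            prec' =2 prec /\ succ' =2 succ
        & is_quadratic_rb_dendriform lambda prec succ P omega]).
Proof.
split=> [prec succ P omega [[dend RBp RBs] quad compat]|
         mul P omega [[mulA RB] nondeg cocycle compat]].
  split=> //; last exact: quadratic_dendriform_cocycle.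
  - by split; [apply: dend_sum_assoc | apply: dend_sum_rota_baxter].
  - by case: quad.
have [prec [succ products]] := cocycle_products_exist nondeg mul.
have quad := cocycle_quadratic nondeg products mulA cocycle.
exists prec, succ; split=> [||] //.
  by move=> prec' succ'; apply: cocycle_products_uniq products.
split=> //; split; first by case: quad.
- exact: (prec_rota_baxter nondeg products).
- exact: (succ_rota_baxter nondeg products).
Qed.
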